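(* (Type $q$-P$(A_4^{(1)})$.) Let $$L_1=\frac{\nu_1\nu_2\nu_3\nu_4(g-\frac{\nu_5}{\kappa_2})(g-\frac{\nu_6}{\kappa_2})}{fg}+\frac{(g\nu_1-1)z}{qg}+\frac{\nu_1\nu_2\nu_3(\frac zq-\nu_4)}{f-\frac zq}(g-T_z^{-1})+\frac{(z-\frac{\kappa_1}{\nu_7})(z-\frac{\kappa_1}{\nu_8})}{q(f-z)}\Bigl(T_z-\frac1g\Bigr).$$ Set $f=\nu_4$. Then the equation $L_1y(z)=0$ is written as $$\Bigl(z-\frac{\kappa_1}{\nu_7}\Bigr)\Bigl(z-\frac{\kappa_1}{\nu_8}\Bigr)y(qz)+\Bigl(-\nu_1z^2+dz-\frac{\kappa_1^2\kappa_2(\nu_5+\nu_6)}{\nu_5\nu_6\nu_7\nu_8}\Bigr)y(z)+q\nu_1\nu_2\nu_3(z-\nu_4)y(z/q)=0,$$ $$d=\frac{\nu_1\{q\nu_2\nu_3(\nu_5+\nu_6)+\kappa_2\nu_4\}}{q\kappa_2}+\frac{(\kappa_1-\nu_4\nu_7)(\kappa_1-\nu_4\nu_8)}{q\nu_4\nu_7\nu_8}\frac1g .$$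
   Context: The parameters $\kappa_1,\kappa_2,\nu_1,\dots,\nu_8$ satisfy $\kappa_1^2\kappa_2^2=q\nu_1\nu_2\cdots\nu_8$. $T_z$ is the $q$-shift operator on the variable $z$: $T_zy(z)=y(qz)$, $T_z^{-1}y(z)=y(z/q)$. $L_1$ is an operator of the Kajiwara–Noumi–Yamada Lax pair for the $q$-Painlevé equation $q$-P$(A_4^{(1)})$, whose dependent variables $f,g$ are here treated as parameters.
   Formalization: The printed equation is false; proved with −qν1ν2ν3(z−ν4)y(z/q) instead of +, and d = ν1{qν2ν3(ν5+ν6)+κ2ν4}/κ2 − (κ1−ν4ν7)(κ1−ν4ν8)/(ν4ν7ν8)·1/g (no q in the denominators, minus sign), for z≠f, z≠qf. *)

(* Defs.v *)
From mathcomp Require Import all_boot all_algebra.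

Set Implicit Arguments.
Unset Strict Implicit.
Unset Printing Implicit Defensive.

Import GRing.Theory.
Local Open Scope ring_scope.

Definition Tz (F : fieldType) (q : F) (y : F -> F) : F -> F :=
  fun z => y (q * z).

Definition Tz_inv (F : fieldType) (q : F) (y : F -> F) : F -> F :=
  fun z => y (z / q).

(* The coefficients are rational functions of z with poles at z = f and
   z = q * f.  Since x / 0 = 0 here, the value at z is meaningful only away
   from these poles and when q, kappa2, nu7, nu8, f and g are nonzero. *)
Definition L1 (F : fieldType) (q kappa1 kappa2 : F)
    (nu1 nu2 nu3 nu4 nu5 nu6 nu7 nu8 f g : F) (y : F -> F) : F -> F :=
  fun z =>
      nu1 * nu2 * nu3 * nu4 * (g - nu5 / kappa2) * (g - nu6 / kappa2)
        / (f * g) * y z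
    + (g * nu1 - 1) * z / (q * g) * y z
    + nu1 * nu2 * nu3 * (z / q - nu4) / (f - z / q)
        * (g * y z - Tz_inv q y z)
    + (z - kappa1 / nu7) * (z - kappa1 / nu8) / (q * (f - z))
        * (Tz q y z - g^-1 * y z).

(* Main.v *)
Require Import Defs.
From mathcomp Require Import all_boot all_algebra.
From mathcomp Require Import ring.

Set Implicit Arguments.
Unset Strict Implicit.
Unset Printing Implicit Defensive.

Import GRing.Theory.
Local Open Scope ring_scope.

(** For f = nu4 the factor (z/q - nu4)/(f - z/q) is -1, so the pole at z = q f
    disappears and clearing the remaining denominator q (f - z) gives a
    three-term equation. The parameter relation then removes the 1/g part of
    the constant coefficient of y(z). *)

Theorem mainTheorem10 (F : fieldType) (q kappa1 kappa2 : F)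
    (nu1 nu2 nu3 nu4 nu5 nu6 nu7 nu8 f g : F)
    (hq : q != 0) (hkappa2 : kappa2 != 0)
    (hnu4 : nu4 != 0) (hnu5 : nu5 != 0) (hnu6 : nu6 != 0)
    (hnu7 : nu7 != 0) (hnu8 : nu8 != 0) (hg : g != 0)
    (hrel : kappa1 ^+ 2 * kappa2 ^+ 2
            = q * (nu1 * nu2 * nu3 * nu4 * nu5 * nu6 * nu7 * nu8))
    (hf : f = nu4) :
  let d := nu1 * (q * nu2 * nu3 * (nu5 + nu6) + kappa2 * nu4) / kappa2
           - (kappa1 - nu4 * nu7) * (kappa1 - nu4 * nu8)
               / (nu4 * nu7 * nu8) * g^-1 in
  forall (y : F -> F) (z : F), z != f -> z != q * f ->
    (L1 q kappa1 kappa2 nu1 nu2 nu3 nu4 nu5 nu6 nu7 nu8 f g y z = 0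
     <->
       (z - kappa1 / nu7) * (z - kappa1 / nu8) * y (q * z)
     + (- nu1 * z ^+ 2 + d * z
        - kappa1 ^+ 2 * kappa2 * (nu5 + nu6) / (nu5 * nu6 * nu7 * nu8)) * y z
     - q * nu1 * nu2 * nu3 * (z - nu4) * y (z / q) = 0).
Proof.
move=> d y z zf zqf.
have fz : f - z != 0 by rewrite subr_eq0 eq_sym.
(* This is the denominator [f - z / q] multiplied by [q], the shape in which [field] asks for it. *)
have fzq : f * q - z != 0 by rewrite subr_eq0 eq_sym mulrC.
set E := (X in _ <-> X = 0).
suff -> : E = q * (f - z)
    * L1 q kappa1 kappa2 nu1 nu2 nu3 nu4 nu5 nu6 nu7 nu8 f g y z.
  split=> [->|/eqP]; first by rewrite mulr0.
  by rewrite !mulf_eq0 (negPf hq) (negPf fz) => /eqP.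
(* The two sides agree only modulo [hrel], so their difference is exhibited as a multiple of that
   relation. *)
apply/eqP; rewrite -subr_eq0; apply/eqP.
(* The cofactor of the parameter relation comes from the coefficients of z/g,
   1/g and 1 in front of y(z). *)
transitivity ((kappa1 ^+ 2 * kappa2 ^+ 2
       - q * (nu1 * nu2 * nu3 * nu4 * nu5 * nu6 * nu7 * nu8))
    * ((1 - z / nu4) / (g * nu7 * nu8 * kappa2 ^+ 2)
       - (nu5 + nu6) / (nu5 * nu6 * nu7 * nu8 * kappa2)) * y z); last first.
  by rewrite hrel subrr !mul0r.
rewrite /E /d /L1 /Tz /Tz_inv; move: fz fzq; rewrite hf => fz fzq.
(* The three values of [y] become independent variables: the identity holds coefficient by
   coefficient. *)
move: (y z) (y (q * z)) (y (z / q)) => y0 y1 y2.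
field.
by rewrite hq hkappa2 hnu4 hnu5 hnu6 hnu7 hnu8 hg fz fzq.
Qed.
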